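(* Let $a:\mathbb{R}^n\to\mathbb{R}^n$ and $b:\mathbb{R}^n\to\mathbb{R}^{n\times p}$ be $C^1$ functions with $a(0)=0$, put $A=\frac{\partial a}{\partial\chi}(0)$ and $B=b(0)$, and assume $(A,B)$ is stabilizable. Let $R\in\mathbb{R}^{p\times p}$ and $Q\in\mathbb{R}^{n\times n}$ be two (symmetric) positive definite matrices. Assume there exists a $C^2$, proper, positive definite function $V:\mathbb{R}^n\to\mathbb{R}_+$ such that: (i) the matrix $P:=\frac12H(V)(0)$ is positive definite and satisfies $$PA+A'P-PBR^{-1}B'P+Q=0;$$ (ii) for all $\chi\in\mathbb{R}^n\setminus\{0\}$, $L_bV(\chi)=0\Rightarrow L_aV(\chi)<0$. Then there exist a continuous function $q:\mathbb{R}^n\to\mathbb{R}_+$, $C^2$ at zero, and a continuous function $r:\mathbb{R}^n\to\mathbb{R}^{p\times p}$ whose values $r(\chi)$ are symmetric positive definite matrices, such that: (a) $H(q)(0)=2Q$ and $r(0)=R$; (b) $V$ is a value function associated to the cost $$J(\chi;u)=\int_0^{+\infty}\Big(q(X(\chi,t;u))+u(t)'\,r(X(\chi,t;u))\,u(t)\Big)\,dt,$$ more precisely $V$ satisfies the Hamilton–Jacobi–Bellman equation $$q(\chi)+L_aV(\chi)-\tfrac14L_bV(\chi)\,r(\chi)^{-1}L_bV(\chi)'=0\qquad\text{for all }\chi\in\mathbb{R}^n .$$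
   Context: The underlying control system is $\dot\chi=a(\chi)+b(\chi)u$, with state $\chi\in\mathbb{R}^n$ and input $u\in\mathbb{R}^p$; $X(\chi,t;u)$ denotes its solution starting from $\chi$ at $t=0$ with control $u:\mathbb{R}_+\to\mathbb{R}^p$. A prime denotes transpose. $H(V)(\chi)$ is the Hessian matrix of $V$ at $\chi$, $(H(V))_{i,j}=\frac{\partial^2V}{\partial\chi_i\partial\chi_j}$. $L_aV(\chi)=\frac{\partial V}{\partial\chi}(\chi)a(\chi)$ and $L_bV(\chi)=\frac{\partial V}{\partial\chi}(\chi)b(\chi)\in\mathbb{R}^{1\times p}$. Positive definite function: $V(0)=0$ and $V(\chi)>0$ for $\chi\neq0$. Proper: preimages of compact sets are compact. ''$q$ is $C^2$ at zero'' is understood pointwise: $q$ is twice differentiable at $0$, so that the Hessian $H(q)(0)$ is defined. That $V$ is a value function associated to the cost $J$ means precisely that $V(0)=0$ and $V$ satisfies the displayed Hamilton–Jacobi–Bellman equation. *)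

(* Defs.v *)
From mathcomp Require Import all_boot all_order all_algebra complex.
From mathcomp Require Import all_classical all_reals all_analysis.
Set Implicit Arguments.
Unset Strict Implicit.
Unset Printing Implicit Defensive.
Import Order.TTheory GRing.Theory Num.Theory.
Import numFieldNormedType.Exports.
Local Open Scope classical_set_scope.
Local Open Scope ring_scope.

(* Points of K^n are column vectors. *)
Section Calculus.
Variables (K : realType) (n : nat).

Definition partial (W : normedModType K) (j : 'I_n) (f : 'cV[K]_n -> W) :
  'cV[K]_n -> W := 'D_(delta_mx j 0) f.

Definition grad (V : 'cV[K]_n -> K) (x : 'cV[K]_n) : 'rV[K]_n :=
  \row_j partial j V x.

(* The library's ['J f p] acts on row vectors and is the transpose of the
   usual Jacobian; here (i, j) is the derivative of f_i with respect to x_j. *)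
Definition jac m (f : 'cV[K]_n -> 'cV[K]_m) (x : 'cV[K]_n) : 'M[K]_(m, n) :=
  \matrix_(i, j) partial j (fun y => f y i 0) x.

Definition hessian (V : 'cV[K]_n -> K) (x : 'cV[K]_n) : 'M[K]_n :=
  \matrix_(i, j) partial i (partial j V) x.

Definition C1 (W : normedModType K) (f : 'cV[K]_n -> W) : Prop :=
  (forall x, differentiable f x) /\ (forall j, continuous (partial j f)).

Definition C2 (W : normedModType K) (f : 'cV[K]_n -> W) : Prop :=
  C1 f /\ (forall j, C1 (partial j f)).

(* Pointwise notion: f is differentiable near x, and its first derivative is
   differentiable at x itself (no continuity of the second derivative). *)
Definition twice_differentiable (W : normedModType K) (f : 'cV[K]_n -> W)
    (x : 'cV[K]_n) : Prop :=
  (\forall y \near x, differentiable f y) /\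
  (forall j, differentiable (partial j f) x).

(* Lie derivative: for k = 1 this is L_f V as a 1 x 1 matrix, for k = p it is
   the row vector of the Lie derivatives along the columns of f. *)
Definition lie k (f : 'cV[K]_n -> 'M[K]_(n, k)) (V : 'cV[K]_n -> K)
    (x : 'cV[K]_n) : 'rV[K]_k :=
  grad V x *m f x.

Definition posdef_fun (V : 'cV[K]_n -> K) : Prop :=
  V 0 = 0 /\ (forall x, x != 0 -> 0 < V x).

Definition proper_fun (V : 'cV[K]_n -> K) : Prop :=
  forall C : set K, compact C -> compact (V @^-1` C).

End Calculus.

Definition posdefmx (K : realType) n (M : 'M[K]_n) : Prop :=
  M^T = M /\ (forall v : 'cV[K]_n, v != 0 -> 0 < (v^T *m M *m v) 0 0).

Definition hurwitz (K : realType) n (M : 'M[K]_n) : Prop :=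
  forall z : K[i],
    eigenvalue (map_mx (real_complex K) M) z -> complex.Re z < 0.

Definition stabilizable (K : realType) n p (A : 'M[K]_n) (B : 'M[K]_(n, p)) :
  Prop := exists F : 'M[K]_(p, n), hurwitz (A + B *m F).

(* V is a value function of  x' = a(x) + b(x) u  for the cost with running
   cost  q(x) + u' r(x) u : it vanishes at 0 and solves the
   Hamilton-Jacobi-Bellman equation. *)
Definition value_function (K : realType) n p
    (a : 'cV[K]_n -> 'cV[K]_n) (b : 'cV[K]_n -> 'M[K]_(n, p))
    (q : 'cV[K]_n -> K) (r : 'cV[K]_n -> 'M[K]_p) (V : 'cV[K]_n -> K) : Prop :=
  V 0 = 0 /\
  (forall x, q x + lie a V x 0 0
     - 4^-1 * (lie b V x *m invmx (r x) *m (lie b V x)^T) 0 0 = 0).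

(* Main.v *)
Require Import Defs.
From mathcomp Require Import all_boot all_order all_algebra complex.
From mathcomp Require Import all_classical all_reals all_analysis.
From mathcomp Require Import ring lra.
Set Implicit Arguments.
Unset Strict Implicit.
Unset Printing Implicit Defensive.
Import Order.TTheory GRing.Theory Num.Theory.
Import numFieldNormedType.Exports.
Local Open Scope classical_set_scope.
Local Open Scope ring_scope.

(** With [S = R^-1], put [alpha = L_aV] and
[beta = 1/4 (L_bV) S (L_bV)'], which is nonnegative and vanishes exactly where
[L_bV] does.  The weight is sought in the form [r = mu^-1 R] with a scalar
[mu > 0]; then the Hamilton-Jacobi-Bellman equation merely says
[q = mu beta - alpha], and what remains is to find a continuous [mu], equal to
1 near the origin, with [mu beta >= alpha] everywhere.

The choice is [mu = max (1, alpha / beta)], read as 1 where [beta = 0].  It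
makes [mu beta >= alpha], because [alpha <= 0] where [beta = 0].  It is
continuous away from 0, because at a point where [beta = 0] the control
Lyapunov condition makes [alpha] negative on a neighbourhood, on which
therefore [mu = 1].  All of this is [dominating_multiplier].

Near the origin one needs [mu = 1], that is [alpha <= beta].  Both functions
are bilinear expressions in maps that vanish at 0 ([a], [grad V] because 0
minimizes [V], hence also [L_bV]), so [beta - alpha] vanishes to first order, and the Riccati equation says that its
Hessian is [2 Q] ([riccati_hessian]).  As [Q] is positive definite, 0 is a
strict local minimum of [beta - alpha] ([strict_local_min]).  Moreover
[q = beta - alpha] near 0, which gives the Hessian of [q].

The subtle point is regularity: [grad V], [a] and [L_bV] are only [C^1], and so
is [beta - alpha].  It is nevertheless twice differentiable at 0, since the
product of a function that is differentiable and null at a point with one that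
is merely continuous there is differentiable at that point
([is_diff_vanishM]).  The derivative of a product [f g] of two [C^1] functions
null at 0 is a sum of such products, hence [critical_zeroM] and, for bilinear
expressions, [critical_zero_form]. *)

(** * Differentiability by explicit estimates *)

Section Differentials.
Variables (K : realType) (U W : normedModType K).
Implicit Types (f g : U -> W) (h : U -> K) (x : U).

Lemma is_diff_eps f (df : {linear U -> W}) x : continuous df ->
  (forall e : K, 0 < e ->
     \forall y \near x, `|f y - f x - df (y - x)| <= e * `|y - x|) ->
  is_diff x f df.
Proof.
move=> dfc H.
have E : f \o shift x = cst (f x) + df +o_ 0 id.
  apply (iffRL (eqaddoP _ _ _ _)) => e e0.
  move: (H e e0); rewrite (near_shift 0 x) /= subr0.
  apply: filterS => y /=.
  by rewrite addrK !fctE /= opprD addrA.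
have D := diff_unique dfc E.
split; last exact: D.
by apply/diff_locallyP; rewrite D.
Qed.

Lemma differentiable_eps f x (e : K) : differentiable f x -> 0 < e ->
  \forall y \near x, `|f y - f x - 'd f x (y - x)| <= e * `|y - x|.
Proof.
move=> /diff_locally df e0.
have := iffLR (eqaddoP _ _ _ _) df e e0.
rewrite (near_shift 0 x) /= subr0; apply: filterS => y /=.
by rewrite addrK !fctE /= opprD addrA.
Qed.

Lemma near_eq_differentiable f g x : {near x, f =1 g} ->
  differentiable f x -> differentiable g x.
Proof.
move=> fg df; have fgx := nbhs_singleton fg.
suff [] : is_diff x g ('d f x) by [].
apply: is_diff_eps; first exact: diff_continuous.
move=> e e0; have := differentiable_eps df e0.
by apply: filterS2 fg => y <-; rewrite -fgx.
Qed.
End Differentials.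

(** The continuous factor contributes only through its value at [x]: the
variation of [h] is multiplied by [f y = O(y - x)], hence negligible. *)
Lemma is_diff_vanishM (K : realType) (U : normedModType K) (f h : U -> K) x :
  differentiable f x -> f x = 0 -> {for x, continuous h} ->
  is_diff x (fun y => f y * h y) (h x \*: 'd f x).
Proof.
move=> df fx0 hc.
have dfc := diff_continuous df.
apply: is_diff_eps; first by move=> y; apply: continuousZl_tmp.
move=> e e0.
have [M M0 HM] := linear_lipschitz dfc.
pose e1 := e / 2 / (`|h x| + 1).
have hx1 : 0 < `|h x| + 1 by rewrite ltr_wpDl.
have e10 : 0 < e1 by rewrite !divr_gt0.
pose e2 := Num.min 1 (e / 2 / M).
have e20 : 0 < e2 by rewrite lt_min ltr01 !divr_gt0.
have := differentiable_eps df e10.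
move/cvgrPdist_le : hc => /(_ _ e20).
apply: filterS2 => y hy fy.
rewrite fx0 mul0r subr0 /= -[_ *: _]/(h x * 'd f x (y - x)).
rewrite fx0 subr0 in fy.
set d := 'd f x (y - x) in fy *.
(* Bounded factor times [o(y - x)], plus [O(y - x)] times a small factor. *)
have -> : f y * h y - h x * d = (f y - d) * h y + d * (h y - h x) by ring.
have hy1 : `|h y| <= `|h x| + 1.
  rewrite -[h y](subrK (h x)) addrC (le_trans (ler_normD _ _))// lerD2l.
  by rewrite distrC (le_trans hy)// ge_min lexx.
rewrite (le_trans (ler_normD _ _))// !normrM.
have -> : e * `|y - x| = e1 * `|y - x| * (`|h x| + 1) + M * `|y - x| * (e / 2 / M).
  rewrite /e1; field; rewrite !gt_eqF//.
rewrite lerD// ler_pM//; first exact: HM.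
by rewrite distrC (le_trans hy)// ge_min lexx orbT.
Qed.

(** * Gradients and functions of class C1 *)

Section Gradients.
Variables (K : realType) (n : nat).
Implicit Types (f g h : 'cV[K]_n -> K) (x v : 'cV[K]_n).

Lemma is_diff_partial f (df : 'cV[K]_n -> K) x j : is_diff x f df ->
  partial j f x = df (delta_mx j 0).
Proof. by move=> D; rewrite /partial deriveE ?diff_val//; apply: ex_diff. Qed.

Lemma diff_grad f x v : differentiable f x -> 'd f x v = (grad f x *m v) 0 0.
Proof.
move=> df.
rewrite [in LHS](matrix_sum_delta v) !linear_sum mxE; apply: eq_bigr => i _.
rewrite linear_sum big_ord1 linearZ /= mxE /partial deriveE//.
by rewrite ord1 mulrC.
Qed.

Lemma is_derive_line f x v (t : K) : differentiable f (x + t *: v) ->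
  is_derive t 1 (fun s : K => f (x + s *: v)) ('d f (x + t *: v) v).
Proof.
move=> df.
have E : (fun h : K => h^-1 *: (((fun s : K => f (x + s *: v)) \o shift t) (h *: 1)
      - f (x + t *: v))) =
    (fun h : K => h^-1 *: ((f \o shift (x + t *: v)) (h *: v) - f (x + t *: v))).
  apply/funext => h /=; congr (_ *: (f _ - _)).
  by rewrite [h *: 1]mulr1 scalerDl addrCA.
have /diff_derivable D := df.
by split; [rewrite /derivable E; exact: D|rewrite -deriveE// /derive E].
Qed.

Lemma grad_at_min f x : (forall y, differentiable f y) ->
  (forall y, f x <= f y) -> grad f x = 0.
Proof.
move=> df fmin; apply/rowP => j; rewrite !mxE /partial deriveE//.
set v := delta_mx j 0; pose phi (t : K) := f (x + t *: v).
have dphi (t : K) : is_derive t (1 : K) phi ('d f (x + t *: v) v) by exact: is_derive_line.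
have : is_derive (0 : K) (1 : K) phi 0.
  apply: (@derive1_at_min K phi (-1) 1) => [|t _||t _].
  - by lra.
  - by have [] := dphi t.
  - by rewrite in_itv /= ltrN10 ltr01.
  - by rewrite /phi scale0r addr0.
by case=> _ <-; have [_ ->] := dphi 0; rewrite scale0r addr0.
Qed.

Lemma partialM f g x j : differentiable f x -> differentiable g x ->
  partial j (fun y => f y * g y) x = f x * partial j g x + g x * partial j f x.
Proof.
move=> df dg; rewrite /partial.
by rewrite (deriveM (diff_derivable df) (diff_derivable dg)).
Qed.

Lemma partialD f g x j : differentiable f x -> differentiable g x ->
  partial j (f + g) x = partial j f x + partial j g x.
Proof.
move=> df dg; rewrite /partial.
by rewrite (deriveD (diff_derivable df) (diff_derivable dg)).
Qed.

Lemma partialZ (c : K) f x j : differentiable f x ->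
  partial j (c *: f) x = c * partial j f x.
Proof. by move=> df; rewrite /partial (deriveZ _ (diff_derivable df)). Qed.

Lemma partial_cst (c : K) x j : partial j (cst c : 'cV[K]_n -> K) x = 0.
Proof. exact: derive_cst. Qed.

Lemma C1_continuous f : C1 f -> continuous f.
Proof. by case=> df _ x; exact: differentiable_continuous. Qed.

Lemma C1_cst (c : K) : C1 (cst c : 'cV[K]_n -> K).
Proof.
split=> [x|j x]; first exact: differentiable_cst.
rewrite (_ : partial j (cst c) = cst 0); first exact: cst_continuous.
by apply/funext => y; rewrite partial_cst.
Qed.

Lemma C1D f g : C1 f -> C1 g -> C1 (f + g).
Proof.
move=> [df cf] [dg cg]; split=> [x|j x]; first exact: differentiableD.
rewrite (_ : partial j (f + g) = partial j f + partial j g).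
  by apply: continuousD; [exact: cf|exact: cg].
by apply/funext => y; rewrite partialD.
Qed.

Lemma C1M f g : C1 f -> C1 g -> C1 (fun y => f y * g y).
Proof.
move=> Cf Cg; have [df cf] := Cf; have [dg cg] := Cg.
split=> [x|j x]; first exact: differentiableM.
rewrite (_ : partial j (fun y => f y * g y)
    = f * partial j g + g * partial j f).
  by apply: continuousD; apply: continuousM;
    [exact: C1_continuous|exact: cg|exact: C1_continuous|exact: cf].
by apply/funext => y; rewrite partialM.
Qed.

Lemma C1_sum (I : finType) (F : I -> 'cV[K]_n -> K) :
  (forall i, C1 (F i)) -> C1 (fun y => \sum_i F i y).
Proof.
move=> CF.
rewrite (_ : (fun y => _) = \sum_i F i); last by apply/funext => y; rewrite fct_sumE.
by apply: (big_ind (@C1 K n K)) => [|f g|i _]; [exact: C1_cst|exact: C1D|].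
Qed.

Lemma C1_form m k (u : 'cV[K]_n -> 'cV[K]_m) (w : 'cV[K]_n -> 'cV[K]_k)
    (S : 'M[K]_(m, k)) :
  (forall i, C1 (fun y => u y i 0)) -> (forall j, C1 (fun y => w y j 0)) ->
  C1 (fun y => ((u y)^T *m S *m w y) 0 0).
Proof.
move=> Cu Cw.
rewrite (_ : (fun y => _) =
    (fun y => \sum_j (\sum_i u y i 0 * cst (S i j) y) * w y j 0)).
  by apply: C1_sum => j; apply: C1M => //; apply: C1_sum => i; apply: C1M => //;
    exact: C1_cst.
apply/funext => y; rewrite mxE; apply: eq_bigr => j _; rewrite mxE.
by congr (_ * _); apply: eq_bigr => i _; rewrite mxE.
Qed.

Lemma partial_sum (I : finType) (F : I -> 'cV[K]_n -> K) x j :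
  (forall i, differentiable (F i) x) ->
  partial j (fun y => \sum_i F i y) x = \sum_i partial j (F i) x.
Proof.
move=> dF.
rewrite (_ : (fun y => _) = \sum_i F i); last by apply/funext => y; rewrite fct_sumE.
pose ok f d := differentiable f x /\ partial j f x = d.
suff [] : ok (\sum_i F i) (\sum_i partial j (F i) x) by [].
apply: (big_ind2 ok) => [|f1 d1 f2 d2 [D1 <-] [D2 <-]|i _].
- by split; [exact: differentiable_cst|exact: partial_cst].
- by split; [exact: differentiableD|exact: partialD].
- by split.
Qed.

Lemma C1_coord m k (M : 'cV[K]_n -> 'M[K]_(m, k)) i j :
  C1 M -> C1 (fun y => M y i j).
Proof.
move=> [dM cM]; split=> [x|l x].
  apply: (@differentiable_comp _ _ _ _ M (fun N : 'M[K]_(m, k) => N i j)) => //.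
  exact: differentiable_coord.
rewrite (_ : partial l _ = (fun y => partial l M y i j)).
  apply: (@continuous_comp _ _ _ (partial l M) (fun N : 'M[K]_(m, k) => N i j)).
    exact: cM.
  exact: coord_continuous.
by apply/funext => y; rewrite /partial (derive_mx (diff_derivable (dM _))) mxE.
Qed.

End Gradients.

(** * Positive definite matrices *)

Section PositiveDefinite.
Variables (K : realType) (n : nat).
Implicit Types (M : 'M[K]_n) (v : 'cV[K]_n).

Lemma posdefmx_ge0 M v : posdefmx M -> 0 <= (v^T *m M *m v) 0 0.
Proof.
case=> _ Mpos; have [->|/Mpos/ltW//] := eqVneq v 0.
by rewrite mulmx0 mxE.
Qed.

Lemma posdefmx_unit M : posdefmx M -> M \in unitmx.
Proof.
case=> _ Mpos; rewrite -row_free_unit; apply: inj_row_free => u uM0.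
apply: contraTeq isT => u0.
have /Mpos : u^T != 0 by rewrite trmx_eq0.
by rewrite trmxK uM0 mul0mx mxE ltxx.
Qed.

Lemma posdefmx_inv M : posdefmx M -> posdefmx (invmx M).
Proof.
move=> Mpos; have Mu := posdefmx_unit Mpos; have [Msym M0] := Mpos.
split=> [|v v0]; first by rewrite trmx_inv Msym.
have w0 : invmx M *m v != 0.
  by apply: contra_neq v0 => w0; rewrite -(mulKVmx Mu v) w0 mulmx0.
have := M0 _ w0; rewrite trmx_mul trmx_inv Msym -!mulmxA mulKVmx//.
Qed.

Lemma posdefmxZ (c : K) M : 0 < c -> posdefmx M -> posdefmx (c *: M).
Proof.
move=> c0 [Msym Mpos]; split=> [|v v0]; first by rewrite linearZ /= Msym.
by rewrite -scalemxAr -scalemxAl mxE mulr_gt0// Mpos.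
Qed.

(** Cauchy-Schwarz for the inner product defined by [M], applied to [v] and
[M^-1 e_i], whose product is [v_i]; coercivity follows by pure algebra. *)
Lemma posdefmx_coord M v i : posdefmx M ->
  v i 0 ^+ 2 <= invmx M i i * (v^T *m M *m v) 0 0.
Proof.
move=> Mpos; have Mu := posdefmx_unit Mpos; have [Msym M0] := Mpos.
pose e : 'cV[K]_n := delta_mx i 0.
have entry (N : 'M[K]_n) : (e^T *m N *m e) 0 0 = N i i.
  by rewrite trmx_delta -rowE -colE !mxE.
have d0 : 0 < invmx M i i.
  rewrite -entry; have [_] := posdefmx_inv Mpos; apply.
  by apply/negP => /eqP/matrixP/(_ i 0); rewrite !mxE !eqxx => /eqP; rewrite oner_eq0.
set d := invmx M i i in d0 *.
(* The minimum over [s] of the form at [v - s y] is reached at [v_i / d]. *)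
pose s := v i 0 / d; pose y := invmx M *m e.
have := posdefmx_ge0 (v - s *: y) Mpos.
have yM : y^T *m M = e^T.
  by rewrite trmx_mul trmx_inv Msym mulmxKV.
have My : M *m y = e by rewrite mulKVmx.
have ev : (e^T *m v) 0 0 = v i 0 by rewrite trmx_delta -rowE mxE.
have ve : (v^T *m e) 0 0 = v i 0 by rewrite -colE !mxE.
have ey : (e^T *m y) 0 0 = d by rewrite mulmxA entry.
have -> : ((v - s *: y)^T *m M *m (v - s *: y)) 0 0 =
    (v^T *m M *m v) 0 0 - v i 0 ^+ 2 / d.
  rewrite [(v - _)^T]linearB /= [(s *: y)^T]linearZ /= mulmxBl -scalemxAl yM.
  rewrite mulmxBl !mulmxBr -!scalemxAl -!scalemxAr -(mulmxA v^T M y) My.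
  have E (a b c f : 'M[K]_1) : (a - b - (c - f)) 0 0 = a 0 0 - b 0 0 - c 0 0 + f 0 0.
    by rewrite !mxE; ring.
  rewrite E; have E2 (c : K) (a : 'M[K]_1) : (c *: a) 0 0 = c * a 0 0 by rewrite mxE.
  by rewrite !E2 ev ve ey /s; field; rewrite gt_eqF.
by rewrite subr_ge0 ler_pdivrMr// mulrC.
Qed.

Lemma cV_norm_coord v i : `|v i 0| <= `|v|.
Proof.
rewrite [leRHS]/Num.Def.normr/= mx_normrE.
exact: (le_bigmax _ _ (i, 0)).
Qed.

Lemma posdefmx_coercive M : posdefmx M ->
  exists2 c : K, 0 < c & forall v, c * `|v| ^+ 2 <= (v^T *m M *m v) 0 0.
Proof.
move=> Mpos.
have d0 i : 0 <= invmx M i i.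
  have := posdefmx_coord (M *m delta_mx i 0) i Mpos.
  have := posdefmx_ge0 (delta_mx i 0) (posdefmx_inv Mpos).
  by rewrite trmx_delta -rowE -colE !mxE.
pose d := 1 + \sum_i invmx M i i.
have dpos : 0 < d by rewrite ltr_wpDr// sumr_ge0.
exists d^-1; first by rewrite invr_gt0.
move=> v; rewrite ler_pdivrMl//.
have [->|v0] := eqVneq v 0; first by rewrite normr0 expr0n mulmx0 mxE mulr0.
have [[i j] /= vE] := mx_norm_neq0 (contra_neq (@mx_norm_eq0 _ _ _ v) v0).
rewrite [`|v|]vE ord1 real_normK ?num_real// (le_trans (posdefmx_coord v i Mpos))//.
rewrite ler_wpM2r ?posdefmx_ge0// /d (bigD1 i)//= addrCA lerDl addr_ge0//.
by rewrite sumr_ge0.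
Qed.

End PositiveDefinite.

(** * Second-order behaviour at a critical zero *)

Section SecondOrder.
Variables (K : realType) (n : nat).
Implicit Types (f g : 'cV[K]_n -> K) (x v : 'cV[K]_n) (H : 'M[K]_n).

(** The second derivative is known at [x] only, so no Taylor formula with a
second-order remainder is used: differentiability of the gradient at [x] makes
[grad f y] have a positive product with [y - x] for [y] near [x], and the mean
value theorem on the segment from [x] to [y] turns this into [f x < f y]. *)
Lemma strict_local_min f x : twice_differentiable f x -> grad f x = 0 ->
  posdefmx (hessian f x) -> \forall y \near x, y != x -> f x < f y.
Proof.
move=> [fd f2] g0 Hpos; set H := hessian f x in Hpos.
have [c c0 Hc] := posdefmx_coercive Hpos.
(* The [n] coordinate errors add up to at most [n e |y - x|^2], which has to
   stay below the coercivity bound. *)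
pose e := c / 2 / (n%:R + 1).
have n1 : 0 < n%:R + 1 :> K by rewrite ltr_wpDl.
have e0 : 0 < e by rewrite !divr_gt0.
have gradE : \forall y \near x, forall j,
    `|partial j f y - ((y - x)^T *m H) 0 j| <= e * `|y - x|.
  suff coordE j : \forall y \near x,
      `|partial j f y - ((y - x)^T *m H) 0 j| <= e * `|y - x|.
    exact: (@filter_forall _ _ (fun j y =>
      `|partial j f y - ((y - x)^T *m H) 0 j| <= e * `|y - x|) (nbhs x) _ coordE).
  have := differentiable_eps (f2 j) e0.
  apply: filterS => y; rewrite diff_grad//.
  have -> : partial j f x = 0 by have /rowP/(_ j) := g0; rewrite !mxE.
  rewrite subr0 (_ : (grad _ _ *m _) 0 0 = ((y - x)^T *m H) 0 j)//.
  by rewrite !mxE; apply: eq_bigr => i _; rewrite !mxE mulrC.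
have radial : \forall y \near x, y != x -> 0 < (grad f y *m (y - x)) 0 0.
  apply: filterS gradE => y Hy yx; set v := y - x in Hy *.
  have v0 : 0 < `|v| by rewrite normr_gt0 subr_eq0.
  have -> : (grad f y *m v) 0 0 = (v^T *m H *m v) 0 0
      + \sum_j (partial j f y - (v^T *m H) 0 j) * v j 0.
    rewrite [(grad f y *m v) 0 0]mxE [(v^T *m H *m v) 0 0]mxE -big_split /=.
    by apply: eq_bigr => j _; rewrite mulrBl addrCA subrr addr0 mxE.
  have : `|\sum_j (partial j f y - (v^T *m H) 0 j) * v j 0| <= n%:R * e * `|v| ^+ 2.
    apply: le_trans (ler_norm_sum _ _ _) _.
    rewrite -mulrA mulr_natl -[X in _ *+ X]card_ord -sumr_const.
    apply: ler_sum => j _.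
    by rewrite normrM expr2 mulrA ler_pM// cV_norm_coord.
  rewrite ler_norml => /andP[+ _]; have := Hc v.
  suff : n%:R * e * `|v| ^+ 2 < c * `|v| ^+ 2 by lra.
  rewrite ltr_pM2r ?exprn_gt0// /e mulrA ltr_pdivrMr//.
  have : 0 <= n%:R :> K by [].
  nra.
have /nbhs_ballP[d /= d0 xd] : nbhs x [set y | differentiable f y /\
    (y != x -> 0 < (grad f y *m (y - x)) 0 0)].
  by apply: filterS2 fd radial.
apply/nbhs_ballP; exists d => //= y xy yx; set v := y - x.
have yE : y = x + v by rewrite addrC subrK.
have vd : `|v| < d by move: xy; rewrite -ball_normE /= distrC.
have line (t : K) : 0 <= t <= 1 -> ball x d (x + t *: v).
  move=> /andP[t0 t1]; rewrite -ball_normE /= opprD addrA subrr sub0r normrN.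
  by rewrite normrZ ger0_norm// (le_lt_trans _ vd)// ler_piMl.
have dline (t : K) : 0 <= t <= 1 ->
    is_derive t (1 : K) (fun s : K => f (x + s *: v)) ('d f (x + t *: v) v).
  by move=> t01; apply: is_derive_line; have [] := xd _ (line _ t01).
have [||t] := @MVT K (fun s => f (x + s *: v)) (fun t => 'd f (x + t *: v) v) 0 1 ltr01.
- by move=> t; rewrite in_itv /= => /andP[/ltW t0 /ltW t1]; apply: dline; rewrite t0.
- apply: derivable_within_continuous => t; rewrite in_itv /= => t01.
  by have [] := dline _ t01.
rewrite in_itv /= => /andP[t0 t1].
rewrite scale1r scale0r addr0 -yE subr0 mulr1 -subr_gt0 => ->.
have t01 : 0 <= t <= 1 by rewrite !ltW.
have [dt rad] := xd _ (line _ t01).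
have E : x + t *: v - x = t *: v by rewrite addrAC subrr add0r.
have : x + t *: v != x by rewrite -subr_eq0 E scaler_eq0 gt_eqF//= subr_eq0.
by move/rad; rewrite E -scalemxAr mxE -diff_grad// pmulr_rgt0.
Qed.

Lemma hessianP f x H :
  hessian f x = H <-> forall i j, partial i (partial j f) x = H i j.
Proof.
split=> [<- i j|fH]; first by rewrite mxE.
by apply/matrixP => i j; rewrite mxE.
Qed.

(** [f] vanishes to first order at [x] and has Hessian [H] there; the conditions
are bundled because sums preserve them together.  They ask nothing about second
derivatives at other points, so products of two [C^1] functions null at [x] qualify. *)
Definition critical_zero f x H : Prop :=
  [/\ twice_differentiable f x, f x = 0, grad f x = 0 & hessian f x = H].

Lemma near_eq_partial f g x : {near x, f =1 g} ->
  \forall y \near x, forall j, partial j f y = partial j g y.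
Proof.
move=> /nbhs_interior fg; apply: filterS fg => y fg j.
exact: near_eq_derive.
Qed.

Lemma critical_zero_near f g x H : {near x, f =1 g} ->
  critical_zero f x H -> critical_zero g x H.
Proof.
move=> fg [[fd f2] fx gf hf].
have pfg j : {near x, partial j f =1 partial j g}.
  by apply: filterS (near_eq_partial fg) => y ->.
split.
- split=> [|j].
    have : \forall y \near x, {near y, f =1 g} := nbhs_interior fg.
    apply: filterS2 fd => y dfy fgy; exact: near_eq_differentiable fgy dfy.
  exact: near_eq_differentiable (pfg j) (f2 j).
- by rewrite -(nbhs_singleton fg).
- by rewrite -gf; apply/rowP => j; rewrite !mxE (nbhs_singleton (pfg j)).
- apply/hessianP => i j; move/hessianP: hf => <-.
  by apply/esym; exact: near_eq_derive.
Qed.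

Lemma critical_zero0 x : critical_zero 0 x 0.
Proof.
have p0 j : partial j (0 : 'cV[K]_n -> K) = 0.
  by apply/funext => y; exact: partial_cst.
split=> //.
- split=> [|j]; last by rewrite p0; exact: differentiable_cst.
  by apply: (@nearW _ (nbhs x)) => y; exact: differentiable_cst.
- by apply/rowP => j; rewrite !mxE p0.
- by apply/hessianP => i j; rewrite mxE p0 partial_cst.
Qed.

Lemma critical_zeroD f g x H H' : critical_zero f x H ->
  critical_zero g x H' -> critical_zero (f + g) x (H + H').
Proof.
move=> [[fd f2] fx gf /hessianP hf] [[gd g2] gx gg /hessianP hg].
have E j : {near x, partial j f + partial j g =1 partial j (f + g)}.
  by apply: filterS2 fd gd => y df dg; rewrite partialD.
have D j : differentiable (partial j f + partial j g) x by exact: differentiableD.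
split.
- split=> [|j]; last exact: near_eq_differentiable (E j) (D j).
  by apply: filterS2 fd gd => y df dg; exact: differentiableD.
- by rewrite fctE fx gx addr0.
- apply/rowP => j; rewrite mxE -(nbhs_singleton (E j)) fctE.
  by move/rowP/(_ j): gf; move/rowP/(_ j): gg; rewrite !mxE => -> ->; rewrite addr0.
- apply/hessianP => i j; rewrite mxE -hf -hg -partialD//; apply/esym.
  exact: near_eq_derive (E j).
Qed.

Lemma critical_zeroZ (c : K) f x H : critical_zero f x H ->
  critical_zero (c *: f) x (c *: H).
Proof.
move=> [[fd f2] fx gf /hessianP hf].
have E j : {near x, c *: partial j f =1 partial j (c *: f)}.
  by apply: filterS fd => y df; rewrite partialZ.
have D j : differentiable (c *: partial j f) x by exact: differentiableZ.
split.
- split=> [|j]; last exact: near_eq_differentiable (E j) (D j).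
  by apply: filterS fd => y df; exact: differentiableZ.
- by rewrite fctE fx scaler0.
- apply/rowP => j; rewrite mxE -(nbhs_singleton (E j)) fctE.
  by move/rowP/(_ j): gf; rewrite !mxE => ->; rewrite scaler0.
- apply/hessianP => i j; rewrite mxE -hf -partialZ//; apply/esym.
  exact: near_eq_derive (E j).
Qed.

Lemma critical_zero_sum (I : finType) (F : I -> 'cV[K]_n -> K)
    (H : I -> 'M[K]_n) x :
  (forall i, critical_zero (F i) x (H i)) ->
  critical_zero (fun y => \sum_i F i y) x (\sum_i H i).
Proof.
move=> cF; rewrite (_ : (fun y => _) = \sum_i F i); last first.
  by apply/funext => y; rewrite fct_sumE.
apply: (big_ind2 (fun f H => critical_zero f x H)) => //.
- exact: critical_zero0.
- by move=> f1 H1 f2 H2; exact: critical_zeroD.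
Qed.

(** [partial j (f g)] is a sum of products of a function null at [x] with a
continuous one, to which [is_diff_vanishM] applies although [f] and [g] may
have no second derivatives. *)
Lemma critical_zeroM f g x : C1 f -> C1 g -> f x = 0 -> g x = 0 ->
  critical_zero (fun y => f y * g y) x
    ((grad f x)^T *m grad g x + (grad g x)^T *m grad f x).
Proof.
move=> Cf Cg fx gx; have [df cf] := Cf; have [dg cg] := Cg.
have E j : partial j (fun y => f y * g y) =
    (fun y => f y * partial j g y) + (fun y => g y * partial j f y).
  by apply/funext => y; rewrite partialM.
have Df j := is_diff_vanishM (df x) fx (cg j x).
have Dg j := is_diff_vanishM (dg x) gx (cf j x).
have DD j := is_diffD (Df j) (Dg j).
split.
- split=> [|j]; last by rewrite E; apply: ex_diff.
  by apply: (@nearW _ (nbhs x)) => y; exact: differentiableM.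
- by rewrite fx mul0r.
- by apply/rowP => j; rewrite !mxE E fctE fx gx !mul0r addr0.
- apply/hessianP => i j; rewrite !mxE E (is_diff_partial i (DD j)).
  rewrite !big_ord1 !mxE fctE /= -!deriveE//.
  by rewrite -[X in X + _ = _]mulrC -[X in _ + X = _]mulrC.
Qed.

(** Covers both terms of the Hamilton-Jacobi-Bellman equation: [L_aV] pairs
[grad V] with [a], and the quadratic term pairs [L_bV] with itself. *)
Lemma critical_zero_form m k (u : 'cV[K]_n -> 'cV[K]_m)
    (w : 'cV[K]_n -> 'cV[K]_k) (S : 'M[K]_(m, k)) x :
  (forall i, C1 (fun y => u y i 0)) -> (forall j, C1 (fun y => w y j 0)) ->
  u x = 0 -> w x = 0 ->
  critical_zero (fun y => ((u y)^T *m S *m w y) 0 0) x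
    ((jac u x)^T *m S *m jac w x + (jac w x)^T *m S^T *m jac u x).
Proof.
move=> Cu Cw ux wx.
have ux0 i : u x i 0 = 0 by rewrite ux mxE.
have wx0 i : w x i 0 = 0 by rewrite wx mxE.
have entry m1 m2 (X : 'M[K]_(m1, n)) (T : 'M[K]_(m1, m2)) (Y : 'M[K]_(m2, n)) a b :
    (X^T *m T *m Y) a b = \sum_j \sum_i T i j * (X i a * Y j b).
  rewrite mxE; apply: eq_bigr => j _; rewrite mxE mulr_suml.
  by apply: eq_bigr => i _; rewrite mxE; ring.
have := critical_zero_sum (fun j => critical_zero_sum (fun i =>
  critical_zeroZ (S i j) (critical_zeroM (Cu i) (Cw j) (ux0 i) (wx0 j)))).
congr (critical_zero _ x _).
- apply/funext => y; rewrite mxE; apply: eq_bigr => j _.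
  rewrite mxE mulr_suml; apply: eq_bigr => i _.
  by rewrite !mxE fctE /= [LHS]mulrA [S i j * _]mulrC.
- apply/matrixP => a b; rewrite summxE [RHS]mxE !entry [X in _ + X]exchange_big.
  rewrite -big_split /=; apply: eq_bigr => j _.
  rewrite summxE -big_split /=; apply: eq_bigr => i _.
  rewrite [S^T _ _]mxE -mulrDr mxE [X in _ * X]mxE; congr (_ * (_ + _)).
    by rewrite mxE big_ord1 !mxE.
  by rewrite mxE big_ord1 !mxE.
Qed.
End SecondOrder.

(** * The multiplier and the Riccati equation *)

(** The multiplier is [max (1, alpha / beta)].  Continuity at the zeros of
[beta] comes from the sign of [alpha]: it is negative around such a point other
than [x0], so the maximum is 1 there, and around [x0] the last hypothesis has
the same effect. *)
Lemma dominating_multiplier (K : realType) (T : topologicalType)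
    (alpha beta : T -> K) (x0 : T) :
  continuous alpha -> continuous beta ->
  (forall y, 0 <= beta y) -> alpha x0 = 0 ->
  (forall y, y != x0 -> beta y = 0 -> alpha y < 0) ->
  (\forall y \near x0, y != x0 -> alpha y < beta y) ->
  exists mu : T -> K,
    [/\ continuous mu, forall y, 1 <= mu y, \forall y \near x0, mu y = 1
      & forall y, alpha y <= mu y * beta y].
Proof.
move=> ca cb b0 ax0 clf dom.
have a0 y : beta y = 0 -> alpha y <= 0.
  by have [->|/clf h /h/ltW//] := eqVneq y x0; rewrite ax0.
(* Division by zero gives 0, so [mu y = 1] where [beta y = 0]. *)
pose mu y := Num.max 1 (alpha y / beta y).
have mu1 y : alpha y <= beta y -> mu y = 1.
  move=> ab; apply/max_idPl; have := b0 y; rewrite le_eqVlt => /predU1P[<-|bpos].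
    by rewrite invr0 mulr0.
  by rewrite ler_pdivrMr// mul1r.
have near1 : \forall y \near x0, mu y = 1.
  apply: filterS dom => y dom_y; apply: mu1.
  have [->|/dom_y/ltW//] := eqVneq y x0; by rewrite ax0.
exists mu; split=> //.
- move=> y; have [->|yx0] := eqVneq y x0.
    rewrite /continuous_at (nbhs_singleton near1).
    exact: cvg_near_cst.
  have := b0 y; rewrite le_eqVlt => /predU1P[/esym by0|bpos].
    have ay : alpha y < 0 by exact: clf.
    have near_y : \forall z \near y, mu z = 1.
      have : \forall z \near y, alpha z < 0 by exact: (cvgr_lt _ (ca y)).
      by apply: filterS => z az; apply: mu1; rewrite (le_trans (ltW az)).
    rewrite /continuous_at (nbhs_singleton near_y).
    exact: cvg_near_cst.
  apply: (@continuous_max _ _ (cst 1) (fun z => alpha z / beta z)); first exact: cvg_cst.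
  by apply: continuousM; [exact: ca|apply: continuousV; [rewrite gt_eqF|exact: cb]].
- by move=> y; rewrite le_max lexx.
- move=> y; have := b0 y; rewrite le_eqVlt => /predU1P[/esym by0|bpos].
    by rewrite by0 mulr0 a0.
  by rewrite -ler_pdivrMr// le_max lexx orbT.
Qed.

(** The left-hand side is the Hessian of [beta - alpha] delivered by
[critical_zero_form], for the Jacobians [2 P] of [grad V], [A] of [a] and
[(2 P B)'] of [(L_bV)'], with the weights [S / 4] and [- 1]. *)
Lemma riccati_hessian (K : realType) n p (A P Q : 'M[K]_n) (B : 'M[K]_(n, p))
    (S : 'M[K]_p) : P^T = P -> S^T = S ->
  P *m A + A^T *m P - P *m B *m S *m B^T *m P + Q = 0 ->
  ((2 *: P *m B)^T)^T *m (4^-1 *: S) *m (2 *: P *m B)^T +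
    ((2 *: P *m B)^T)^T *m (4^-1 *: S)^T *m (2 *: P *m B)^T +
  ((2 *: P)^T *m - 1%:M *m A + A^T *m (- 1%:M)^T *m (2 *: P)) = 2 *: Q.
Proof.
move=> Psym Ssym; rewrite addrC => /eqP; rewrite addr_eq0 opprB => /eqP ->.
rewrite trmxK [(4^-1 *: S)^T]linearZ /= Ssym trmx_mul [(2 *: P)^T]linearZ /= Psym.
rewrite [(- 1%:M)^T]linearN /= trmx1 !mulmxN !mulmx1 !mulNmx.
rewrite -?(scalemxAl, scalemxAr) !mulmxA ?scalerA.
move: (_ *m P) (P *m A) (_ *m P) => X Y Z.
by apply/matrixP => i j; rewrite !mxE; field.
Qed.

Theorem theorem2 (K : realType) (n p : nat)
    (a : 'cV[K]_n -> 'cV[K]_n) (b : 'cV[K]_n -> 'M[K]_(n, p))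
    (A : 'M[K]_n) (B : 'M[K]_(n, p)) (R : 'M[K]_p) (Q : 'M[K]_n)
    (V : 'cV[K]_n -> K) (P : 'M[K]_n)
    (ha : C1 a) (hb : C1 b) (ha0 : a 0 = 0)
    (hA : A = jac a 0) (hB : B = b 0) (hAB : stabilizable A B)
    (hR : posdefmx R) (hQ : posdefmx Q)
    (hV2 : C2 V) (hVproper : proper_fun V) (hVpos : posdef_fun V)
    (hP : P = 2^-1 *: hessian V 0) (hPpos : posdefmx P)
    (hric : P *m A + A^T *m P - P *m B *m invmx R *m B^T *m P + Q = 0)
    (hclf : forall x, x != 0 -> lie b V x = 0 -> lie a V x 0 0 < 0) :
  exists (q : 'cV[K]_n -> K) (r : 'cV[K]_n -> 'M[K]_p),
    [/\ continuous q, (forall x, 0 <= q x) & twice_differentiable q 0] /\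
    [/\ continuous r & (forall x, posdefmx (r x))] /\
    [/\ hessian q 0 = 2 *: Q & r 0 = R] /\
    value_function a b q r V.
Proof.
have [V0 Vpos] := hVpos; have [[dV _] CdV] := hV2.
have gV0 : grad V 0 = 0.
  apply: grad_at_min => // y; rewrite V0.
  by have [->|/Vpos/ltW//] := eqVneq y 0; rewrite V0.
have pV0 j : partial j V 0 = 0 by have /rowP/(_ j) := gV0; rewrite !mxE.
have HP : hessian V 0 = 2 *: P by rewrite hP scalerA mulfV// scale1r.
have [Psym _] := hPpos; have [Ssym _] := posdefmx_inv hR.
have Ru := posdefmx_unit hR.
set S := invmx R in hric Ssym.
pose gV y := (grad V y)^T; pose L y := (lie b V y)^T.
have gVE i : (fun y => gV y i 0) = partial i V by apply/funext => y; rewrite !mxE.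
have LE k : (fun y => L y k 0) = (fun y => \sum_j partial j V y * b y j k).
  by apply/funext => y; rewrite !mxE; apply: eq_bigr => j _; rewrite mxE.
have CgV i : C1 (fun y => gV y i 0) by rewrite gVE.
have Cbjk j k : C1 (fun y => b y j k) by exact: C1_coord.
have CpVb k j : C1 (fun y => partial j V y * b y j k) by exact: C1M.
have CL (k : 'I_p) : C1 (fun y => L y k 0) by rewrite LE; exact: C1_sum (CpVb k).
have Ca i : C1 (fun y => a y i 0) by exact: C1_coord.
have gV00 : gV 0 = 0 by rewrite /gV gV0 trmx0.
have L00 : L 0 = 0 by rewrite /L /lie gV0 mul0mx trmx0.
have JgV : jac gV 0 = 2 *: P.
  by rewrite -Psym -linearZ /= -HP; apply/matrixP => i j; rewrite !mxE gVE.
(* [grad V] vanishes at 0, so the derivatives of [b] do not contribute. *)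
have JL : jac L 0 = (2 *: P *m B)^T.
  rewrite -HP hB; apply/matrixP => k i; rewrite mxE LE partial_sum; last first.
    by move=> j; case: (CpVb k j).
  rewrite !mxE; apply: eq_bigr => j _.
  rewrite partialM; last 2 first.
  - by case: (CdV j).
  - by case: (Cbjk j k).
  by rewrite pV0 mul0r add0r mxE mulrC.
pose alpha y := lie a V y 0 0.
pose beta y := 4^-1 * (lie b V y *m S *m (lie b V y)^T) 0 0.
have q0crit : critical_zero (fun y => beta y - alpha y) 0 (2 *: Q).
  have c1 := critical_zero_form (4^-1 *: S) CL CL L00 L00.
  have c2 := critical_zero_form (- 1%:M) CgV Ca gV00 ha0.
  have := critical_zeroD c1 c2; congr (critical_zero _ 0 _).
    apply/funext => y; rewrite fctE /beta /alpha /L /gV !trmxK; congr (_ + _).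
      by rewrite -scalemxAr -scalemxAl mxE.
    by rewrite mulmxN mulmx1 mulNmx mxE.
  rewrite JgV JL -hA; exact: riccati_hessian.
have ca : continuous alpha.
  have /C1_continuous := C1_form 1%:M CgV Ca.
  rewrite (_ : (fun y => _) = alpha)//; apply/funext => y.
  by rewrite /gV trmxK mulmx1.
have cb : continuous beta.
  have /C1_continuous := C1_form (4^-1 *: S) CL CL.
  rewrite (_ : (fun y => _) = beta)//; apply/funext => y.
  by rewrite /L trmxK -scalemxAr -scalemxAl mxE.
have b0 y : 0 <= beta y.
  rewrite mulr_ge0//.
  have := posdefmx_ge0 (L y) (posdefmx_inv hR); by rewrite trmxK.
have a00 : alpha 0 = 0 by rewrite /alpha /lie gV0 mul0mx mxE.
have clf y : y != 0 -> beta y = 0 -> alpha y < 0.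
  move=> y0 by0; apply: hclf => //; apply: contra_eq by0 => Ly.
  rewrite gt_eqF// mulr_gt0//.
  have [_ /(_ (L y))] := posdefmx_inv hR; rewrite trmxK; apply.
  by rewrite trmx_eq0.
have dom : \forall y \near (0 : 'cV[K]_n), y != 0 -> alpha y < beta y.
  have [q0t q00 q0g q0H] := q0crit.
  have := strict_local_min q0t q0g; rewrite q0H q00 => /(_ (posdefmxZ _ hQ)).
  move=> /(_ ltac:(by [])); apply: filterS => y h /h.
  by rewrite subr_gt0.
have [mu [cmu mu1 munear mudom]] := dominating_multiplier ca cb b0 a00 clf dom.
have mupos y : 0 < mu y by rewrite (lt_le_trans _ (mu1 y)).
have mu0 : mu 0 = 1 by exact: nbhs_singleton munear.
pose q y := mu y * beta y - alpha y.
have qcrit : critical_zero q 0 (2 *: Q).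
  apply: critical_zero_near q0crit.
  by apply: filterS munear => y muy; rewrite /q muy mul1r.
have [qt _ _ qH] := qcrit.
exists q, (fun y => (mu y)^-1 *: R); split; [split|split; [split|split; [split|split]]] => //.
- move=> y; apply: (@continuousB _ _ _ (mu * beta) alpha); last exact: ca.
  by apply: continuousM; [exact: cmu|exact: cb].
- by move=> y; rewrite subr_ge0.
- move=> y; have cmuV : {for y, continuous (fun z => (mu z)^-1)}.
    by apply: continuousV; [rewrite gt_eqF|exact: cmu].
  exact: continuousZr_tmp cmuV.
- by move=> y; apply: posdefmxZ => //; rewrite invr_gt0.
- by rewrite mu0 invr1 scale1r.
- move=> y.
  have muu : (mu y)^-1 \is a GRing.unit by rewrite unitfE invr_eq0 gt_eqF.
  rewrite invmxZ ?unitmxZ// invrK -/S.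
  have scaleE (c : K) (N : 'M[K]_1) : (c *: N) 0 0 = c * N 0 0 by rewrite mxE.
  by rewrite -scalemxAr -scalemxAl scaleE /q /beta /alpha; ring.
Qed.
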